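(* Let $F$ be an infinite field and let $X\subseteq F$ be additively symmetric and generic, in the sense that finitely many additive translates of $X$ cover $F$. Then $4X+X\cdot 4X=F$.
   Context: Additively symmetric means $0\in X$ and $X=-X$. For subsets $Y,Z$ of a field, $Y+Z=\{y+z\}$, $Y\cdot Z=\{yz\}$ ($y\in Y,z\in Z$), and $nZ$ is the set of sums of $n$ elements of $Z$. *)

(* Defs.v *)
From mathcomp Require Import all_boot all_order all_algebra.
From mathcomp Require Export boolp classical_sets cardinality.

Set Implicit Arguments.
Unset Strict Implicit.
Unset Printing Implicit Defensive.

Import GRing.Theory.
Local Open Scope classical_set_scope.
Local Open Scope ring_scope.

Definition sumset (F : fieldType) (Y Z : set F) : set F :=
  [set y + z | y in Y & z in Z].

Definition prodset (F : fieldType) (Y Z : set F) : set F :=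
  [set y * z | y in Y & z in Z].

(* The n summands need not be distinct, and [nsumset 0 Z] is [set 0]. *)
Definition nsumset (F : fieldType) (n : nat) (Z : set F) : set F :=
  [set \sum_(i < n) z i | z in [set z : 'I_n -> F | forall i, Z (z i)]].

Definition additively_symmetric (F : fieldType) (X : set F) : Prop :=
  X 0 /\ X = [set - x | x in X].

Definition generic (F : fieldType) (X : set F) : Prop :=
  exists2 C : set F,
    finite_set C & \bigcup_(c in C) [set c + x | x in X] = [set: F].

(* Main.v *)
(** Write [F] as the union of the [c + X] with [c] in a finite set [C], and
    colour each [e] by the translates containing [e] and [c * e], [c] in [C].
    As [F] is infinite, two distinct elements have the same colour; their
    difference [e] is nonzero, and [e] and all [c * e] lie in [X - X = 2X].
    Given [t], write [t / e = c + x] with [c] in [C] and [x] in [X]; then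
    [t = c * e + x * e] lies in [2X + X * 2X]. *)
Require Import Defs.
From mathcomp Require Import all_boot all_order all_algebra.

Set Implicit Arguments.
Unset Strict Implicit.
Unset Printing Implicit Defensive.

Import GRing.Theory.
Local Open Scope classical_set_scope.
Local Open Scope ring_scope.

Lemma infinite_pigeonhole (T : choiceType) (K : finType) (f : T -> K) :
  infinite_set [set: T] -> exists a b, a != b /\ f a = f b.
Proof.
move=> Tinf; apply: contrapT => noncoll; apply: Tinf.
suff finj : {in f @^-1` [set: K] &, injective f}.
  by rewrite -(preimage_setT f); apply: finite_preimage.
move=> a b _ _ fab; apply/eqP; apply: contrapT => /negP ab.
by apply: noncoll; exists a, b.
Qed.

Lemma nsumset_sub (F : fieldType) (X : set F) n x y :
  additively_symmetric X -> X x -> X y -> nsumset n.+2 X (x - y).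
Proof.
move=> [X0 XN] Xx Xy.
(* Past the two listed entries, the default value [0] of [nth] supplies the other [n] summands; it
   lies in [X]. *)
exists (fun i : 'I_n.+2 => [:: x; - y]`_i).
  by move=> [[|[|i]] ?] //=; rewrite ?nth_nil // XN; exists y.
rewrite !big_ord_recl big1 ?addr0 //= => i _.
by rewrite nth_nil.
Qed.

Lemma generic_common_difference (F : fieldType) (X : set F) n (s : seq F) :
    infinite_set [set: F] -> additively_symmetric X -> generic X ->
  exists2 e, e != 0 & forall c, c \in s -> nsumset n.+2 X (c * e).
Proof.
move=> Finf Xsym [C /finite_seqP[r ->] Ccov].
have col y : exists k : seq_sub r, X (y - val k).
  have [] : (\bigcup_(c in [set` r]) [set c + x | x in X]) y by rewrite Ccov.
  by move=> c rc [x Xx <-]; exists (SeqSub rc); rewrite addrC addKr.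
have [k kP] := choice col.
have [a [b [ab /ffunP fab]]] :=
  infinite_pigeonhole (fun e => [ffun c : seq_sub s => k (val c * e)]) Finf.
exists (a - b); first by rewrite subr_eq0.
move=> c sc; have := fab (SeqSub sc); rewrite !ffunE /= => kab.
(* [c * a] and [c * b] have the same chosen centre, which cancels and leaves a difference of two
   elements of [X]. *)
have -> : c * (a - b) = (c * a - val (k (c * a))) - (c * b - val (k (c * b))).
  by rewrite kab opprB addrA subrK mulrBr.
exact: nsumset_sub.
Qed.

Theorem corollary1p13 (F : fieldType) (X : set F)
  (Finf : infinite_set [set: F]%classic)
  (Xsym : additively_symmetric X) (Xgen : generic X) :
  sumset (nsumset 4 X) (prodset X (nsumset 4 X)) = [set: F]%classic.
Proof.
apply/seteqP; split=> // t _.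
have [C /finite_seqP[s ->] Ccov] := Xgen.
(* The entry [1] puts [e] itself in [4X]; padding by [2] zeros turns [2X] into [4X]. *)
have [e e0 se] := generic_common_difference 2 (1 :: s) Finf Xsym Xgen.
have [c sc [x Xx cx]] : (\bigcup_(c in [set` s]) [set c + x | x in X]) (t / e).
  by rewrite Ccov.
exists (c * e); first by apply: se; rewrite inE sc orbT.
exists (x * e); last by rewrite -mulrDl cx divfK.
by exists x => //; exists e => //; rewrite -[e]mul1r; apply: se; rewrite mem_head.
Qed.
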